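(* Let $\mathcal H$ be a hypergraph on a finite set $V$ with $\Delta(\mathcal H)\le2$. A nonempty set $S\subseteq V$ is an inclusion-minimal nonempty stopping set of $\mathcal H$ if and only if $E_S$ is a circuit of the graphic matroid of $Q_{\mathcal H}$. Equivalently, $E_S$ is a loop at the apex, a pair of parallel edges, or the edge set of a simple cycle of length at least three.
   Context: A hypergraph on a finite set $V$ is a family $\mathcal H\subseteq 2^V$; $\Delta(\mathcal H)=\max_{v\in V}|\{A\in\mathcal H:v\in A\}|$ (empty maximum zero). A stopping set of $\mathcal H$ is a set $S\subseteq V$ with $|A\cap S|\neq1$ for every $A\in\mathcal H$. For $\Delta(\mathcal H)\le2$, the labeled multigraph $Q_{\mathcal H}$ has vertex set $\mathcal H\cup\{\alpha\}$, where $\alpha$ is a new vertex called the apex, and one edge $e_x$ for each $x\in V$: if $x$ belongs to two hyperedges $A$ and $B$, then $e_x$ joins $A$ and $B$; if $x$ belongs to exactly one hyperedge $A$, then $e_x$ joins $A$ to $\alpha$; if $x$ belongs to no hyperedge, then $e_x$ is a loop at $\alpha$. Parallel edges are retained (distinct $x$ give distinct edges). For $S\subseteq V$, $E_S=\{e_x:x\in S\}$. *)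

(* Defs.v *)
From mathcomp Require Import all_boot.
Set Implicit Arguments.
Unset Strict Implicit.
Unset Printing Implicit Defensive.

Section Hypergraph.

Variable V : finType.

Definition hypergraph := {set {set V}}.

Definition max_degree (H : hypergraph) : nat :=
  \max_(v : V) #|[set A in H | v \in A]|.

Definition stopping_set (H : hypergraph) : pred {set V} :=
  fun S => [forall A in H, #|A :&: S| != 1].

Definition minimal_stopping_set (H : hypergraph) (S : {set V}) : bool :=
  minset (fun T => (T != set0) && stopping_set H T) S.

End Hypergraph.

(* [ends e] is the set of endpoints of [e]: a loop has one, any other edge two.
   Distinct edges may have the same ends. *)
Structure multigraph := Multigraph {
  vertex : finType;
  edge : finType;
  ends : edge -> {set vertex};
  card_ends : forall e, 0 < #|ends e| <= 2
}.

Arguments ends {m} _.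

Section Multigraph.

Variable G : multigraph.
Implicit Types (e f : edge G) (F : {set edge G}).

Definition is_loop_at (v : vertex G) e : bool := ends e == [set v].

Definition parallel e f : bool :=
  [&& e != f, #|ends e| == 2 & ends e == ends f].

(* [:: (v_0, e_0); ...; (v_k-1, e_k-1)] with k > 0, the v_i pairwise distinct,
   the e_i pairwise distinct, and e_i joining v_i to v_(i+1 mod k).  A loop is
   the case k = 1 and a pair of parallel edges the case k = 2. *)
Definition simple_cycle (c : seq (vertex G * edge G)) : bool :=
  [&& 0 < size c, uniq (unzip1 c), uniq (unzip2 c)
    & cycle (fun p q => ends p.2 == [set p.1; q.1]) c].

Definition cycle_edges (c : seq (vertex G * edge G)) : {set edge G} :=
  [set e in unzip2 c].

(* The independent sets of the graphic matroid of G. *)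
Definition forest F : Prop :=
  forall c, simple_cycle c -> ~~ (cycle_edges c \subset F).

End Multigraph.

(* The circuits of a matroid on E, given by its independent sets, are the
   minimal dependent sets. *)
Definition circuit (E : finType) (indep : {set E} -> Prop) (C : {set E}) :=
  ~ indep C /\ forall D : {set E}, D \proper C -> indep D.

Definition graphic_circuit (G : multigraph) (C : {set edge G}) : Prop :=
  circuit (@forest G) C.

Section QGraph.

Variables (V : finType) (H : hypergraph V).

Definition hyperedge := {A : {set V} | A \in H}.

(* The apex is [None]. *)
Definition Q_ends (x : V) : {set option hyperedge} :=
  let D := [set A : hyperedge | x \in val A] in
  match #|D| with
  | 0 => [set None]
  | 1 => None |: Some @: D
  | _ => Some @: D
  end.

Hypothesis degH : max_degree H <= 2.

Fact card_Q_ends x : 0 < #|Q_ends x| <= 2.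
Proof.
have le2 : #|[set A : hyperedge | x \in val A]| <= 2.
  apply: leq_trans degH; apply: leq_trans (leq_bigmax x).
  rewrite -(card_imset _ val_inj); apply/subset_leq_card/subsetP => B.
  by case/imsetP=> A; rewrite !inE => xA ->; rewrite (valP A).
rewrite /Q_ends; set D := [set A | _] in le2 *.
have cD : #|Some @: D| = #|D| by apply: card_imset => ? ? [].
case E: #|D| => [|[|n]]; first by rewrite cards1.
  by rewrite cardsU1 cD E; case: (_ \notin _).
by rewrite cD E; rewrite E in le2.
Qed.

(* The edge e_x is x itself. *)
Definition Q : multigraph := Multigraph card_Q_ends.

Definition apex : vertex Q := None.

Definition Q_edges (S : {set V}) : {set edge Q} := S.

End QGraph.

(* Main.v *)
Require Import Defs.
From mathcomp Require Import all_boot.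
Set Implicit Arguments.
Unset Strict Implicit.
Unset Printing Implicit Defensive.

(** Call a vertex a leaf of an edge set F when it meets exactly one edge of F
    and that edge is not a loop.  In Q_H the edges at a hyperedge A are the
    e_x with x in A and none of them is a loop, so S is a stopping set exactly
    when no vertex other than the apex is a leaf of E_S.  The proposition thus
    reduces to facts about leaves in an arbitrary multigraph with a
    distinguished vertex a.

    The edge set of a simple cycle has no leaf at all ([cycle_leafless]).
    Conversely a nonempty F whose only possible leaf is a contains a simple
    cycle ([leafless_off_cycle]): a path of F that starts at a if F meets a
    ends at a vertex different from a, hence not a leaf, so it can be prolonged
    by a new edge; this cannot go on forever, and the first time the new edge
    returns to the path it closes a cycle.  So a set is a forest iff it
    contains no nonempty set that is leafless away from a, whence circuits are
    the inclusion-minimal such sets ([circuit_leafless_off]); with a the apex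
    these are the minimal nonempty stopping sets.

    Finally the circuits are precisely the edge sets of simple cycles
    ([circuit_cycle]): a nonempty leafless subset of a cycle contains with each
    edge the following one, hence all of them ([leafless_sub_cycle]).  Sorting
    cycles by length 1, 2 and at least 3 gives the explicit description, as
    every loop of Q_H is at the apex. *)

(** Since P is boolean, a dependent set yields an actual member of P inside it,
    although independence is only a proposition; forests will be treated this
    way, with P a decidable property of edge sets implied by being a cycle. *)
Lemma circuit_minset (E : finType) (indep : {set E} -> Prop)
    (P : pred {set E}) (C : {set E}) :
    (forall D, indep D <-> forall T : {set E}, P T -> ~~ (T \subset D)) ->
  circuit indep C <-> minset P C.
Proof.
move=> indepP; split=> [[depC minC] | /minsetP[PC minC]].
  have noP (T : {set E}) : T \proper C -> ~~ P T.
    by move/minC/indepP=> noT; apply/negP=> /noT; rewrite subxx.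
  have PC : P C.
    apply/negPn/negP=> nPC; apply/depC/indepP => T PT; apply/negP => sTC.
    have [eTC | neTC] := eqVneq T C; first by rewrite -eTC PT in nPC.
    by move: (noP T); rewrite properEneq neTC sTC PT => /(_ isT).
  apply/minsetP; split=> // T PT sTC; apply/eqP/negPn/negP => neTC.
  by move: (noP T); rewrite properEneq neTC sTC PT => /(_ isT).
split=> [/indepP/(_ C PC) | D ltDC]; first by rewrite subxx.
apply/indepP=> T PT; apply/negP=> sTD.
have eTC := minC T PT (subset_trans sTD (proper_sub ltDC)).
by move: ltDC; rewrite properE -eTC sTD andbF.
Qed.

Lemma in_uniq_map_inj (T1 T2 : eqType) (h : T1 -> T2) (s : seq T1) :
  uniq (map h s) -> {in s &, injective h}.
Proof.
elim: s => //= t s IHs /andP[hNs uhs] t1 t2; rewrite !inE.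
case/predU1P=> [-> | t1s] /predU1P[-> | t2s] // eqh.
- by rewrite eqh map_f in hNs.
- by rewrite -eqh map_f in hNs.
by apply: IHs.
Qed.

(** * Leaves and cycles in a multigraph *)

Section Leaves.

Variable G : multigraph.
Implicit Types (e f : edge G) (F D : {set edge G}) (u v w a : vertex G).
Implicit Types (c q : seq (vertex G * edge G)) (x y z r : vertex G * edge G).

Definition leaf F v : bool :=
  [exists e in F, (#|ends e| == 2) && ([set f in F | v \in ends f] == [set e])].

Definition leafless_off a F : bool :=
  (F != set0) && [forall v, (v != a) ==> ~~ leaf F v].

Definition joins x y : bool := ends x.2 == [set x.1; y.1].

Lemma not_leaf_other_edge F v e :
    ~~ leaf F v -> e \in F -> v \in ends e -> #|ends e| = 2 ->
  exists2 f, f \in F & (f != e) && (v \in ends f).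
Proof.
move=> noleaf eF ve e2.
have [[f /and3P[fF fe vf]] | none] :=
  altP (@existsP _ (fun f => [&& f \in F, f != e & v \in ends f])).
  by exists f; rewrite ?fe.
case/negP: noleaf; apply/existsP; exists e; rewrite eF e2 eqxx /=.
apply/eqP/setP=> f; rewrite !inE.
have [-> | fe] := eqVneq f e; first by rewrite eF ve.
apply/negP=> /andP[fF vf]; case/existsP: none.
by exists f; rewrite fF fe.
Qed.

Lemma card_joins x y : joins x y -> (#|ends x.2| == 2) = (x.1 != y.1).
Proof. by move/eqP->; rewrite cards2; case: (x.1 == y.1). Qed.

Lemma simple_cycle1 v e : simple_cycle [:: (v, e)] = is_loop_at v e.
Proof. by rewrite /simple_cycle /= setUid andbT. Qed.

Lemma simple_cycle2 u v e f :
  simple_cycle [:: (u, e); (v, f)] =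
    [&& u != v, e != f, ends e == [set u; v] & ends f == [set v; u]].
Proof. by rewrite /simple_cycle /= !inE !andbT. Qed.

Section InCycle.

Variables (c : seq (vertex G * edge G)) (cyc : simple_cycle c).

Let uniq_vertices : uniq (unzip1 c). Proof. by case/and4P: cyc. Qed.
Let uniq_edges : uniq (unzip2 c). Proof. by case/and4P: cyc. Qed.
Let uniq_c : uniq c. Proof. exact: map_uniq uniq_vertices. Qed.

Lemma cycle_edgesP e :
  reflect (exists2 r, r \in c & e = r.2) (e \in cycle_edges c).
Proof. by rewrite inE; apply: mapP. Qed.

Lemma joins_next r : r \in c -> joins r (next c r).
Proof. by apply: next_cycle; case/and4P: cyc. Qed.

Lemma cycle_vertex_inj : {in c &, injective (fun r => r.1)}.
Proof. exact: in_uniq_map_inj. Qed.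

Lemma cycle_edge_inj : {in c &, injective (fun r => r.2)}.
Proof. exact: in_uniq_map_inj. Qed.

Lemma cycle_edges_neq0 : cycle_edges c != set0.
Proof.
case/and4P: cyc; case: c => // r s _ _ _ _.
by apply/set0Pn; exists r.2; rewrite !inE eqxx.
Qed.

(** An end of the edge of r is either the vertex of r, which the preceding
    edge also meets, or the vertex of its successor, which the following edge
    also meets; unless the cycle is a loop, that other edge is distinct. *)
Lemma cycle_leafless v : ~~ leaf (cycle_edges c) v.
Proof.
apply/negP=> /existsP[e /and3P[/cycle_edgesP[r rc ->] e2 /eqP only_e]].
have onlyP s : s \in c -> v \in ends s.2 -> s = r.
  move=> sc vs; apply: cycle_edge_inj => //.
  apply/set1P; rewrite -only_e inE vs andbT.
  by apply/cycle_edgesP; exists s.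
have ne_next : next c r <> r.
  move=> e_next; have := joins_next rc; rewrite e_next => /card_joins.
  by rewrite e2 eqxx.
have : v \in ends r.2.
  by have := set11 r.2; rewrite -only_e inE => /andP[].
have /eqP -> := joins_next rc; rewrite !inE => /orP[] /eqP ev.
  have pc : prev c r \in c by rewrite mem_prev.
  have e_prev : prev c r = r.
    apply: onlyP => //; have /eqP -> := joins_next pc.
    by rewrite next_prev // ev !inE eqxx orbT.
  by apply: ne_next; rewrite -{1}e_prev next_prev.
have nc : next c r \in c by rewrite mem_next.
apply/ne_next/onlyP => //; have /eqP -> := joins_next nc.
by rewrite ev !inE eqxx.
Qed.

(** The only edges of the cycle at the vertex of [next c r] are those of r and
    of [next c r]; so if D contains the first, leaflessness forces the
    second, and D is closed under [next]. *)
Lemma leafless_sub_cycle D :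
    D \subset cycle_edges c -> D != set0 -> (forall v, ~~ leaf D v) ->
  D = cycle_edges c.
Proof.
move=> /subsetP sDc /set0Pn[e0 De0] noleaf.
have next_closed r : r \in c -> r.2 \in D -> (next c r).2 \in D.
  move=> rc Dr; have nc : next c r \in c by rewrite mem_next.
  have jr := joins_next rc.
  have [e1 | ner] := eqVneq r.1 (next c r).1.
    by rewrite -(cycle_vertex_inj rc nc e1).
  have vr : (next c r).1 \in ends r.2 by rewrite (eqP jr) !inE eqxx orbT.
  have r2 : #|ends r.2| = 2 by apply/eqP; rewrite (card_joins jr).
  have [f Df /andP[nef]] := not_leaf_other_edge (noleaf _) Dr vr r2.
  have /cycle_edgesP[s sc fs] := sDc f Df.
  rewrite fs (eqP (joins_next sc)) !inE => /orP[] /eqP ev.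
    by rewrite (cycle_vertex_inj nc sc ev) -fs.
  have /(cycle_vertex_inj nc) := ev; rewrite mem_next => /(_ sc) e_next.
  have e_rs : r = s by rewrite -(prev_next uniq_c r) e_next prev_next.
  by rewrite fs e_rs eqxx in nef.
have /cycle_edgesP[r0 r0c e0r] := sDc e0 De0.
have iterD n : (iter n (next c) r0 \in c) && ((iter n (next c) r0).2 \in D).
  elim: n => [|n /andP[nc Dn]] /=; first by rewrite r0c -e0r.
  by rewrite mem_next nc next_closed.
apply/eqP; rewrite eqEsubset; apply/andP; split; apply/subsetP=> // e.
case/cycle_edgesP=> r rc ->.
have r0r : fconnect (next c) r0 r.
  by rewrite (fconnect_cycle (cycle_next uniq_c) r0c).
by rewrite -(iter_findex r0r); case/andP: (iterD (findex (next c) r0 r)).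
Qed.

End InCycle.

(** * Prolonging a path until it closes up *)

(** In the lemmas below [x :: q] lists a path backwards, each vertex paired
    with the edge by which it was reached; z carries the starting vertex and
    its edge component is arbitrary. *)
Lemma path_avoids x q z v r :
    path joins x (rcons q z) -> v \notin unzip1 (x :: rcons q z) ->
  r \in x :: q -> v \notin ends r.2.
Proof.
elim: q x => [|y q IHq] x /= /andP[/eqP jx].
  rewrite !inE !negb_or => _ /andP[vx vz] /eqP ->.
  by rewrite jx !inE negb_or vx.
move=> pyq; rewrite inE negb_or => /andP[vx vyq].
rewrite inE => /predU1P[-> | rq]; last exact: IHq pyq vyq rq.
by move: vyq; rewrite jx !inE !negb_or vx => /andP[].
Qed.

Lemma path_uniq_edges x q z :
    path joins x (rcons q z) -> uniq (unzip1 (x :: rcons q z)) ->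
  uniq (unzip2 (x :: q)).
Proof.
elim: q x => [|y q IHq] x //= /andP[/eqP jx pyq] /andP[xN uyq].
apply/andP; split; last exact: IHq pyq uyq.
apply/negP=> /(@mapP _ _ _ (y :: q))[r rq exr].
have := path_avoids pyq xN rq.
by rewrite -exr jx !inE eqxx.
Qed.

Lemma close_path x q y f :
    path joins x (rcons q y) -> uniq (unzip1 (x :: rcons q y)) ->
    ends f = [set y.1; x.1] -> f != x.2 ->
  simple_cycle ((y.1, f) :: x :: q).
Proof.
move=> pq uq ef nef; apply/and4P; split=> //.
- have : uniq (unzip1 (rcons (x :: q) y)) by [].
  by rewrite /unzip1 map_rcons rcons_uniq.
- rewrite /= -/(unzip2 (x :: q)) in uq *; apply/andP; split.
    rewrite inE negb_or nef; apply/negP=> /mapP[r rq efr].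
    (* f meets x.1, which no edge of the path except x.2 does, so f is not one of them *)
    have xr : x.1 \in ends r.2 by rewrite -efr ef !inE eqxx orbT.
    case: q pq uq rq => //= t q /andP[_ ptq] /andP[xN _] rq.
    by have := path_avoids ptq xN rq; rewrite xr.
  exact: path_uniq_edges pq uq.
rewrite /= ef eqxx /=; move: pq; rewrite !rcons_path => /andP[-> jl].
exact: jl.
Qed.

Lemma exists_other_end e v :
  #|ends e| = 2 -> v \in ends e -> exists2 w, w != v & ends e = [set w; v].
Proof.
move/eqP/cards2P=> [u [w [neuw ->]]]; rewrite !inE => /orP[] /eqP ->.
  by exists w; rewrite 1?eq_sym // setUC.
by exists u.
Qed.

(** A loop in F is a cycle by itself.  Otherwise the path starts at a, unless F
    misses a, so that its current end x.1, which differs from its start, is not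
    a: x.1 is no leaf and a second edge of F leaves it.  This edge closes a
    cycle or prolongs the path, and no path has more than #|vertex G|
    vertices. *)
Lemma leafless_off_cycle a F :
  leafless_off a F -> exists2 c, simple_cycle c & cycle_edges c \subset F.
Proof.
case/andP=> /set0Pn[e0 Fe0] /forallP noleaf.
have [/existsP[e /andP[eF /cards1P[v ev]]] | noloop] :=
  boolP [exists e in F, #|ends e| == 1].
  exists [:: (v, e)]; first by rewrite /simple_cycle /= ev setUid eqxx.
  by apply/subsetP=> f; rewrite !inE => /eqP ->.
have F2 e : e \in F -> #|ends e| = 2.
  move=> eF; have := card_ends e.
  have : #|ends e| != 1.
    by apply: contraNneq noloop => e1; apply/existsP; exists e; rewrite eF e1.
  by case: #|ends e| => [|[|[|]]].
have [z [x [jx nexz Fx startP]]] : exists z x,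
    [/\ joins x z, x.1 != z.1, x.2 \in F
      & forall e, e \in F -> a \in ends e -> a = z.1].
  have [/existsP[e /andP[eF ae]] | aN] :=
    boolP [exists e in F, a \in ends e].
    have [w newa ew] := exists_other_end (F2 e eF) ae.
    by exists (a, e), (w, e); split; rewrite ?/joins /= ?ew.
  have /eqP/cards2P[u [w [neuw euw]]] := F2 e0 Fe0.
  exists (w, e0), (u, e0); split; rewrite ?/joins /= ?euw // => e eF ae.
  by case/existsP: aN; exists e; rewrite eF.
(* either a cycle was met, or there are paths of every length *)
have grow n : (exists2 c, simple_cycle c & cycle_edges c \subset F) \/
    exists x q, [/\ path joins x (rcons q z), uniq (unzip1 (x :: rcons q z)),
      {subset unzip2 (x :: q) <= F} & size q = n].
  elim: n => [|n [|[{nexz Fx jx}x [q [pq uq sqF szq]]]]].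
  - right; exists x, [::]; split=> //=; rewrite ?jx ?inE ?nexz //.
    by move=> e; rewrite inE => /eqP ->.
  - by left.
  have Fx : x.2 \in F by apply: sqF; rewrite inE eqxx.
  have xx : x.1 \in ends x.2.
    by case: (q) pq => [|t q'] /= /andP[/eqP -> _]; rewrite !inE eqxx.
  have nexa : x.1 != a.
    apply: contraTneq uq => exa; have := startP _ Fx; rewrite -exa => /(_ xx).
    by move=> e1; rewrite /unzip1 /= map_rcons e1 mem_rcons inE eqxx.
  have [f fF /andP[nef xf]] :=
    not_leaf_other_edge (implyP (noleaf _) nexa) Fx xx (F2 _ Fx).
  have [w newx ef] := exists_other_end (F2 f fF) xf.
  have [wq | wNq] := boolP (w \in unzip1 (x :: rcons q z)); last first.
    right; exists (w, f), (x :: q); split=> //=; last by rewrite szq.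
    - by rewrite /joins /= ef eqxx.
    - by rewrite wNq.
    by move=> e; rewrite inE => /predU1P[-> // | /sqF].
  left; move: wq; rewrite /= inE (negPf newx) => /mapP[y yq ewy].
  case/splitPr def_q: _ / yq pq uq => [q1 q2].
  rewrite -cat_rcons cat_path => /andP[pq1 _].
  rewrite /unzip1 -cat_cons map_cat cat_uniq => /andP[uq1 _].
  exists ((y.1, f) :: x :: q1); first by apply: close_path; rewrite -?ewy.
  have sub_q : {subset q1 <= q}.
    move=> r rq1; have szle : size q1 <= size q.
      have /(congr1 size) := def_q; rewrite size_rcons size_cat /= addnS.
      by case=> ->; rewrite leq_addr.
    have /(congr1 (take (size q1))) := def_q.
    rewrite take_size_cat // -cats1 takel_cat // => e_q1.
    by apply: (@mem_take (size q1)); rewrite e_q1.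
  apply/subsetP=> e; rewrite !inE => /or3P[/eqP -> // | /eqP -> // |].
  case/mapP=> r /sub_q rq ->; apply: sqF.
  by rewrite inE (map_f (fun r => r.2) rq) orbT.
case: (grow #|vertex G|) => // -[x' [q [_ uq _ szq]]].
have := max_card (mem (unzip1 (x' :: rcons q z))).
by rewrite (card_uniqP uq) size_map /= size_rcons szq ltnNge leqW.
Qed.

(** * Circuits of the graphic matroid *)

Lemma cycle_leafless_off a c :
  simple_cycle c -> leafless_off a (cycle_edges c).
Proof.
move=> cyc; rewrite /leafless_off cycle_edges_neq0 //=.
by apply/forallP=> v; rewrite cycle_leafless ?implybT.
Qed.

Lemma circuit_leafless_off a F :
  graphic_circuit F <-> minset (leafless_off a) F.
Proof.
apply: circuit_minset => D; split=> [forestD T /leafless_off_cycle[c cyc sT] |].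
  by apply: contra (forestD c cyc); apply: subset_trans.
by move=> noT c cyc; apply/noT/cycle_leafless_off.
Qed.

Lemma circuit_cycle F :
  graphic_circuit F <-> exists2 c, simple_cycle c & F = cycle_edges c.
Proof.
split=> [cF | [c cyc ->]].
  have /set0Pn[e _] : F != set0.
    apply: contra_notN (proj1 cF) => /eqP -> c cyc.
    by rewrite subset0 cycle_edges_neq0.
  have /andP[/card_gt0P[a _] _] := card_ends e.
  have /minsetP[ll minF] := proj1 (circuit_leafless_off a F) cF.
  have [c cyc sc] := leafless_off_cycle ll.
  by exists c => //; rewrite (minF _ (cycle_leafless_off a cyc) sc).
split=> [/(_ c cyc) | D ltD c' cyc']; first by rewrite subxx.
apply: contraTN ltD => sc'D; rewrite properE negb_and negbK -implybE.
apply/implyP=> sD.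
by rewrite -(leafless_sub_cycle cyc (subset_trans sc'D sD)
  (cycle_edges_neq0 cyc') (cycle_leafless cyc')).
Qed.

End Leaves.

(** * The multigraph of a hypergraph *)

Section QGraph.

Variables (V : finType) (H : hypergraph V) (degH : max_degree H <= 2).

Lemma mem_Q_ends (A : hyperedge H) (x : V) :
  (Some A \in Q_ends H x) = (x \in val A).
Proof.
rewrite /Q_ends; set D := [set B | _].
have mD : (Some A \in Some @: D) = (x \in val A).
  by rewrite mem_imset ?inE // => ? ? [].
case E: #|D| => [|[|n]]; rewrite ?in_setU1 ?mD //.
by rewrite -mD (cards0_eq E) imset0 !inE.
Qed.

Lemma Q_no_loop (A : hyperedge H) (x : V) : x \in val A -> #|Q_ends H x| = 2.
Proof.
move=> xA; have := card_Q_ends degH x; rewrite /Q_ends; set D := [set B | _].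
have cD : #|Some @: D| = #|D| by apply: card_imset => ? ? [].
have D_gt0 : 0 < #|D| by apply/card_gt0P; exists A; rewrite inE.
case E: #|D| D_gt0 => [|[|n]] // _.
  rewrite cardsU1 cD E; case: imsetP => [[] //|//].
by rewrite cD E; case: n {E}.
Qed.

Lemma leaf_Q (S : {set V}) (A : hyperedge H) :
  leaf (Q_edges degH S) (Some A : vertex (Q degH)) = (#|val A :&: S| == 1).
Proof.
have star : [set f in Q_edges degH S | (Some A : vertex (Q degH)) \in ends f]
    = val A :&: S.
  by apply/setP=> x; rewrite !inE andbC [_ \in ends _]mem_Q_ends.
rewrite /leaf star; apply/existsP/cards1P => [[x /and3P[_ _ /eqP]] | [x ex]].
  by exists x.
have /setIP[xA xS] : x \in val A :&: S by rewrite ex set11.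
by exists x; rewrite xS ex eqxx andbT; apply/eqP/(Q_no_loop xA).
Qed.

Lemma stopping_set_leafless (S : {set V}) :
  (S != set0) && stopping_set H S = leafless_off (apex degH) (Q_edges degH S).
Proof.
rewrite /leafless_off; congr (_ && _); apply/forallP/forallP => noleaf.
  case=> [A|]; apply/implyP=> // _.
  by rewrite leaf_Q; apply: (implyP (noleaf (val A))); apply: valP.
move=> A; apply/implyP=> HA.
by have := noleaf (Some (Sub A HA)); rewrite leaf_Q.
Qed.

Lemma loop_at_apex (x : edge (Q degH)) (v : vertex (Q degH)) :
  ends x = [set v] -> v = apex degH.
Proof.
case: v => // A ex; have : (Some A : vertex (Q degH)) \in ends x.
  by rewrite ex set11.
rewrite [_ \in _]mem_Q_ends => /Q_no_loop ex2.
by have := cards1 (Some A : vertex (Q degH)); rewrite -ex [#|_|]ex2.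
Qed.

End QGraph.

Theorem proposition5p6 (V : finType) (H : hypergraph V)
    (degH : max_degree H <= 2) (S : {set V}) (S_neq0 : S != set0) :
  (minimal_stopping_set H S <-> graphic_circuit (Q_edges degH S)) /\
  (graphic_circuit (Q_edges degH S) <->
     [\/ exists2 e : edge (Q degH),
           is_loop_at (apex degH) e & Q_edges degH S = [set e],
         exists e f : edge (Q degH),
           parallel e f /\ Q_edges degH S = [set e; f]
       | exists c : seq (vertex (Q degH) * edge (Q degH)),
           [/\ simple_cycle c, 3 <= size c & Q_edges degH S = cycle_edges c]]).
Proof.
split.
  rewrite /minimal_stopping_set.
  rewrite (minset_eq _ (fun T => stopping_set_leafless degH T)).
  by have [] := circuit_leafless_off (apex degH) (Q_edges degH S); split.
split=> [/circuit_cycle[c cyc eS] | shape]; last first.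
  apply/circuit_cycle; case: shape =>
    [[e /eqP eloop ->] | [e [f [/and3P[nef e2 /eqP eef] ->]]] | [c [cyc _ ->]]].
  - exists [:: (apex degH, e)]; last by apply/setP=> g; rewrite !inE.
    by rewrite simple_cycle1 /is_loop_at eloop.
  - have /cards2P[u [v [neuv euv]]] := e2.
    exists [:: (u, e); (v, f)]; last by apply/setP=> g; rewrite !inE.
    by rewrite simple_cycle2 neuv nef -eef euv eqxx setUC eqxx.
  by exists c.
case: c cyc eS => [|[u e] [|[v f] [|r c]]] cyc eS.
- by [].
- constructor 1; exists e; last by rewrite eS; apply/setP=> g; rewrite !inE.
  move: cyc; rewrite simple_cycle1 => /eqP eu.
  by rewrite /is_loop_at -(loop_at_apex eu) eu.
- constructor 2; exists e, f; split.
    move: cyc; rewrite simple_cycle2 => /and4P[neuv neef /eqP eu /eqP fv].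
    by rewrite /parallel neef eu fv cards2 neuv setUC eqxx.
  by rewrite eS; apply/setP=> g; rewrite !inE.
by constructor 3; exists [:: (u, e), (v, f), r & c].
Qed.
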